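(* Let $X$ be a complex Hilbert space, let $E=E^*$ and $A=A^*$ be bounded operators on $X$, let $\mathcal{A}(\mu)=\mu E-A$, and let $\lambda\in\mathbb{R}\cap\rho(\mathcal{A})$, i.e. $\lambda\in\mathbb{R}$ and $\lambda E-A$ is bijective. Put $J=(\lambda E-A)^{-1}$ and $[x,y]=(Jx,y)$ for $x,y\in X$. Then the linear relation $\mathcal{L}=\{\{Ez,Az\}\mid z\in X\}\subseteq X\times X$ is selfadjoint with respect to $[\cdot,\cdot]$, i.e. $\mathcal{L}=\mathcal{L}^+$.
   Context: $(\cdot,\cdot)$ is the inner product of the Hilbert space $X$. Since $J$ is bounded, selfadjoint and boundedly invertible, $(X,[\cdot,\cdot])$ is a Krein space. A linear relation in $X$ is a linear subspace of $X\times X$. The adjoint of a linear relation $\mathcal{L}$ with respect to $[\cdot,\cdot]$ is $\mathcal{L}^+=\{\{x,y\}\in X\times X\mid [x,t]=[y,z]\text{ for all }\{z,t\}\in\mathcal{L}\}$. *)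

(* Defs.v *)
From HB Require Import structures.
From mathcomp Require Import all_boot all_order all_algebra.
From mathcomp Require Import complex.
From mathcomp Require Import boolp classical_sets functions reals.
From mathcomp Require Import topology normedtype.

Set Implicit Arguments.
Unset Strict Implicit.
Unset Printing Implicit Defensive.

Import Order.TTheory GRing.Theory Num.Theory Num.Def.
Import numFieldNormedType.Exports.

Local Open Scope classical_set_scope.
Local Open Scope ring_scope.
Local Open Scope complex_scope.

Section BoundedOperators.
Context {R : realType} {X : normedModType R[i]}.

Definition bounded_operator (T : {linear X -> X}) : Prop :=
  exists M : R, forall x : X, `|T x| <= M%:C * `|x|.

End BoundedOperators.

Section HilbertSpaces.
Context {R : realType} {X : completeNormedModType R[i]}.

(* A {dot X for conjC} is linear in its first argument, conjugate-linear in the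
   second and positive definite. A Hilbert space is a complete normed space
   whose norm is induced by such a form. *)
Definition induces_norm (ip : {dot X for conjC}) : Prop :=
  forall x : X, `|x| ^+ 2 = ip x x.

(* [S] is the Hilbert space adjoint of the everywhere defined operator [T];
   such an [S] is unique, since [ip] is definite *)
Definition is_adjoint (ip : {dot X for conjC}) (T S : X -> X) : Prop :=
  forall x y : X, ip (T x) y = ip x (S y).

Definition selfadjoint_operator (ip : {dot X for conjC}) (T : X -> X) : Prop :=
  is_adjoint ip T T.

End HilbertSpaces.

Section Pencil.
Context {R : realType} {X : normedModType R[i]} (E A : {linear X -> X}).

Definition pencil (mu : R[i]) : X -> X := fun x => mu *: E x - A x.

Definition resolvent_set : set R[i] := [set mu | bijective (pencil mu)].

(* [pinv] is an arbitrary total function when [pencil mu] is not bijective;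
   it is only meant for [mu] in the resolvent set *)
Definition resolvent (mu : R[i]) : X -> X := pinv setT (pencil mu).

Definition pencil_relation : set (X * X) := range (fun z => (E z, A z)).

End Pencil.

Section LinearRelations.
Context {R : realType} {X : lmodType R[i]}.

Definition linear_relation (L : set (X * X)) : Prop :=
  L 0 /\ forall (a : R[i]) (p q : X * X), L p -> L q -> L (a *: p + q).

(* pairs p = {x, y} and q = {z, t} *)
Definition relation_adjoint (form : X -> X -> R[i]) (L : set (X * X))
    : set (X * X) :=
  [set p | forall q, L q -> form p.1 q.2 = form p.2 q.1].

Definition selfadjoint_relation (form : X -> X -> R[i]) (L : set (X * X))
    : Prop :=
  linear_relation L /\ L = relation_adjoint form L.

End LinearRelations.

(* Main.v *)
Require Import Defs.
From mathcomp Require Import all_boot all_order all_algebra.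
From mathcomp Require Import complex.
From mathcomp Require Import boolp classical_sets functions reals.
From mathcomp Require Import topology normedtype.
Import numFieldNormedType.Exports.
Local Open Scope classical_set_scope.
Local Open Scope ring_scope.
Local Open Scope complex_scope.

(** With [J = (mu E - A)^-1], membership of [{x, y}] in the relation is the single
    equation [A J x = E J y]. Since [E] and [A] are symmetric, the
    condition [[x, A w] = [y, E w]] for all [w] defining the adjoint is the same
    equation tested against all vectors [w]. *)

Import Order.TTheory GRing.Theory.

Section Pencil.
Variables (R : realType) (X : normedModType R[i]) (E A : {linear X -> X}).

Lemma pencil_relation_linear : linear_relation (pencil_relation E A).
Proof.
split=> [|a p q [z _ <-] [w _ <-]].
  by exists 0 => //; rewrite !linear0.
by exists (a *: z + w) => //; rewrite !linearP.
Qed.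

Variable mu : R[i].

(** [pencil] is a bare function carrying no linear structure; this shape is used with [a] equal to
    [mu]. *)
Lemma pencilZB (a : R[i]) (x y : X) :
  pencil E A mu (a *: x - y) = a *: pencil E A mu x - pencil E A mu y.
Proof.
rewrite /pencil [E _]linearB [A _]linearB !linearZ /= !scalerBr !scalerA mulrC.
by rewrite !opprD !opprK addrACA.
Qed.

Hypothesis mu_resolvent : resolvent_set E A mu.

Lemma pencilK : cancel (pencil E A mu) (resolvent E A mu).
Proof.
move=> x; apply: pinvKV; rewrite ?in_setT//.
by move=> y z _ _; apply: bij_inj mu_resolvent y z.
Qed.

(** By surjectivity each vector is a value of the pencil, so the left inverse is also a right
    inverse. *)
Lemma resolventK : cancel (resolvent E A mu) (pencil E A mu).
Proof.
have [g _ pencil_g] := mu_resolvent.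
by move=> x; rewrite -(pencil_g x) pencilK.
Qed.

Lemma pencil_relationP (x y : X) :
  pencil_relation E A (x, y) <->
  A (resolvent E A mu x) = E (resolvent E A mu y).
Proof.
split=> [[z _ [<- <-]]|AJxEJy].
  (* This is [A z = mu *: E z - pencil z] with the resolvent applied to both sides. *)
  have -> : resolvent E A mu (A z) = mu *: resolvent E A mu (E z) - z.
    rewrite -[RHS]pencilK; congr resolvent.
    by rewrite pencilZB resolventK subKr.
  by rewrite linearB linearZ /= -{3}[E z]resolventK subKr.
(* The witness is forced: [x = E z] and [y = A z] give [mu *: x - y = pencil z], and the resolvent
   recovers [z]. *)
exists (mu *: resolvent E A mu x - resolvent E A mu y) => //.
(* Exchanging [E J y] and [A J x] once in each component leaves the pencil at [J x] and at [J y],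
   that is, [x] and [y]. *)
rewrite !linearB !linearZ /= -AJxEJy {2}AJxEJy.
by congr pair; rewrite -[LHS]/(pencil E A mu _) resolventK.
Qed.

End Pencil.

(** Testing with [w = x - y] makes [ip (x - y) (x - y)] vanish, against positive definiteness unless
    [x = y]. *)
Lemma dot_injl (R : numDomainType) (theta : R -> R) (X : lmodType R)
    (ip : {dot X for theta}) (x y : X) :
  (forall w, ip x w = ip y w) -> x = y.
Proof.
move=> ipxy; apply/eqP; rewrite -subr_eq0; apply/negP => /negP xy_neq0.
have := @neq0_dnorm_gt0 _ _ _ ip _ xy_neq0.
by rewrite linearBl /= ipxy subrr ltxx.
Qed.

Theorem theorem5p1 (R : realType) (X : completeNormedModType R[i])
    (ip : {dot X for Num.Def.conjC}) (ip_norm : induces_norm ip)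
    (E A : {linear X -> X})
    (E_bounded : bounded_operator E) (A_bounded : bounded_operator A)
    (E_selfadjoint : selfadjoint_operator ip E)
    (A_selfadjoint : selfadjoint_operator ip A)
    (lambda : R) (lambda_resolvent : resolvent_set E A lambda%:C) :
  let J := resolvent E A lambda%:C in
  let krein := fun x y : X => ip (J x) y in
  selfadjoint_relation krein (pencil_relation E A).
Proof.
move=> J krein; split; first exact: pencil_relation_linear.
apply/seteqP; split=> -[x y].
  move=> /(pencil_relationP _ _ _ _ _ lambda_resolvent) AJxEJy _ [w _ <-].
  by rewrite /krein /= -A_selfadjoint -E_selfadjoint AJxEJy.
move=> Lxy; apply/(pencil_relationP _ _ _ _ _ lambda_resolvent)/(dot_injl _ _ _ ip) => w.
(* With [A] and [E] moved onto [w], the goal is the adjoint condition at the pair [(E w, A w)]. *)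
rewrite A_selfadjoint E_selfadjoint.
by apply: (Lxy (E w, A w)); exists w.
Qed.
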